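(* Let $n$ be an odd positive integer. Then, up to isomorphism, there exists a unique indecomposable solution $(X,r)$ whose permutation group $\mathcal{G}(X,r)$ is isomorphic to the dihedral group of order $2n$. Moreover, such a solution is uniconnected.
   Context: A solution is a pair $(X,r)$ with $X$ a non-empty set and $r:X\times X\to X\times X$, $r(x,y)=(\sigma_x(y),\tau_y(x))$, such that $(r\times \mathrm{id})(\mathrm{id}\times r)(r\times \mathrm{id})=(\mathrm{id}\times r)(r\times \mathrm{id})(\mathrm{id}\times r)$ on $X^3$, $r^2=\mathrm{id}$ (involutive), and all maps $\sigma_x,\tau_y:X\to X$ are bijections (non-degenerate). Two solutions $(X,r)$, $(X',r')$ are isomorphic if there is a bijection $f:X\to X'$ with $r'(f\times f)=(f\times f)r$. The permutation group $\mathcal{G}(X,r)$ is the subgroup of $\mathrm{Sym}(X)$ generated by all $\sigma_x$. $(X,r)$ is indecomposable if $\mathcal{G}(X,r)$ acts transitively on $X$, and uniconnected if $\mathcal{G}(X,r)$ acts regularly on $X$. *)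

(* Defs.v *)
From HB Require Import structures.
From mathcomp Require Import all_boot all_algebra all_fingroup all_solvable.
From mathcomp Require Import boolp classical_sets.

Set Implicit Arguments.
Unset Strict Implicit.
Unset Printing Implicit Defensive.

(* Sym X for an arbitrary (possibly infinite) X; the inverse is carried as data
   and is determined by the underlying function, see symP. The product is
   composition of functions: (f * g) x = f (g x), unlike in {perm T}. *)
Record sym (X : Type) := Sym {
  sym_fun :> X -> X;
  sym_inv : X -> X;
  sym_funK : cancel sym_fun sym_inv;
  sym_invK : cancel sym_inv sym_fun
}.

Lemma symP (X : Type) (f g : sym X) : f =1 g -> f = g.
Proof.
case: f g => [f f' fK f'K] [g g' gK g'K] /= /funext efg.
rewrite -{}efg in gK g'K *; have ef : g' = f'.
  by apply: funext => x; rewrite -{1}(f'K x) gK.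
by rewrite ef in gK g'K *; congr Sym; apply: Prop_irrelevance.
Qed.

Section SymGroup.
Variable X : Type.

HB.instance Definition _ := gen_eqMixin (sym X).
HB.instance Definition _ := gen_choiceMixin (sym X).

Definition sym_one : sym X := @Sym X id id (fun=> erefl) (fun=> erefl).

Definition sym_mul (f g : sym X) : sym X :=
  Sym (can_comp (@sym_funK X f) (@sym_funK X g))
      (can_comp (@sym_invK X g) (@sym_invK X f)).

Definition sym_opp (f : sym X) : sym X := Sym (@sym_invK X f) (@sym_funK X f).

Fact sym_mulA : associative sym_mul. Proof. by move=> f g h; apply: symP. Qed.
Fact sym_mul1 : left_id sym_one sym_mul. Proof. by move=> f; apply: symP. Qed.
Fact sym_mulr1 : right_id sym_one sym_mul. Proof. by move=> f; apply: symP. Qed.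
Fact sym_mulV : left_inverse sym_one sym_opp sym_mul.
Proof. by move=> f; apply: symP => x /=; rewrite sym_funK. Qed.
Fact sym_mulrV : right_inverse sym_one sym_opp sym_mul.
Proof. by move=> f; apply: symP => x /=; rewrite sym_invK. Qed.

HB.instance Definition _ :=
  isGroup.Build (sym X) sym_mulA sym_mul1 sym_mulr1 sym_mulV sym_mulrV.

End SymGroup.

Section Subgroups.
Local Open Scope group_scope.
Local Open Scope classical_set_scope.

Definition is_subgroup (G : groupType) (H : set G) : Prop :=
  [/\ H 1, (forall x y, H x -> H y -> H (x * y)) & (forall x, H x -> H x^-1)].

Definition generated_subgroup (G : groupType) (A : set G) : set G :=
  smallest (@is_subgroup G) A.

Definition subgroup_isom (G K : groupType) (H : set G) : Prop :=
  exists phi : K -> G,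
    [/\ {morph phi : x y / x * y}, injective phi & range phi = H].

Definition acts_transitively (X : Type) (H : set (sym X)) : Prop :=
  forall x y : X, exists g : sym X, H g /\ g x = y.

Definition acts_regularly (X : Type) (H : set (sym X)) : Prop :=
  forall x y : X, exists! g : sym X, H g /\ g x = y.

End Subgroups.

(* The semidirect product of Z/n by Z/2 acting by inversion, for n > 0: (i, b)
   stands for rho^i s^b with rho of order n, s of order 2, s rho s = rho^-1.
   The additive group of 'I_n.-1.+1 is Z/n for every n > 0. The library's
   'D_(n.*2) agrees with it for n > 1 (dihedral_isog) but does not have order 2
   for n = 1, 'Z_1 having two elements. *)
Variant dihedral (n : nat) : Type := Dihedral of 'I_n.-1.+1 & bool.

Section DihedralGroup.
Variable n : nat.
Local Open Scope ring_scope.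

Definition dihedral_rot (u : dihedral n) : 'I_n.-1.+1 :=
  let: Dihedral i _ := u in i.
Definition dihedral_ref (u : dihedral n) : bool := let: Dihedral _ b := u in b.

Definition pair_of_dihedral (u : dihedral n) := (dihedral_rot u, dihedral_ref u).
Definition dihedral_of_pair (p : 'I_n.-1.+1 * bool) := Dihedral p.1 p.2.
Fact pair_of_dihedralK : cancel pair_of_dihedral dihedral_of_pair.
Proof. by case. Qed.
Fact dihedral_of_pairK : cancel dihedral_of_pair pair_of_dihedral.
Proof. by case. Qed.

HB.instance Definition _ :=
  Finite.copy (dihedral n) (can_type pair_of_dihedralK).

Definition dihedral_mul (u v : dihedral n) : dihedral n :=
  let: Dihedral i b := u in let: Dihedral j c := v in
  Dihedral (i + (if b then - j else j)) (b (+) c).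
Definition dihedral_one : dihedral n := Dihedral 0 false.
Definition dihedral_inv (u : dihedral n) : dihedral n :=
  let: Dihedral i b := u in Dihedral (if b then i else - i) b.

Fact dihedral_mulA : associative dihedral_mul.
Proof.
move=> [i b] [j c] [k d] /=; rewrite addbA.
by case: b c => [] [] /=; rewrite ?GRing.opprD ?GRing.opprK GRing.addrA.
Qed.

Fact dihedral_mul1 : left_id dihedral_one dihedral_mul.
Proof. by case=> i b /=; rewrite GRing.add0r. Qed.

Fact dihedral_mulV : left_inverse dihedral_one dihedral_inv dihedral_mul.
Proof. by case=> i [] /=; rewrite ?GRing.subrr ?GRing.addNr. Qed.

HB.instance Definition _ := Finite_isGroup.Build (dihedral n)
  dihedral_mulA dihedral_mul1 dihedral_mulV.

Lemma card_dihedral_group : (0 < n)%N -> #|{: dihedral n}| = n.*2.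
Proof.
move=> n0; rewrite (bij_eq_card (Bijective pair_of_dihedralK dihedral_of_pairK)).
by rewrite card_prod card_ord card_bool prednK // muln2.
Qed.

Lemma dihedral_isog : (1 < n)%N -> [set: dihedral n] \isog 'D_n.*2.
Proof.
move=> n1; have n0 := ltnW n1.
rewrite isogEcard card_dihedral // cardsT card_dihedral_group // leqnn andbT.
rewrite Grp_dihedral //; apply/existsP.
pose rho : dihedral n := Dihedral (inord 1) false.
pose s : dihedral n := Dihedral 0 true.
have rhoX k : (rho ^+ k)%g = Dihedral (inord (k %% n)) false.
  elim: k => [|k IHk].
    by congr Dihedral; apply: val_inj; rewrite /= mod0n inordK.
  rewrite expgS IHk; congr Dihedral; apply: val_inj => /=.
  rewrite !inordK ?prednK ?ltn_pmod //.
  by rewrite modnDmr add1n.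
exists (rho, s); rewrite /= !xpair_eqE; apply/and4P; split.
- rewrite finset.eqEsubset finset.subsetT; apply/fintype.subsetP => -[i b] _.
  have -> : Dihedral i b = (rho ^+ i * s ^+ b)%g.
    rewrite rhoX modn_small; last by rewrite -[X in (_ < X)%N](prednK n0).
    rewrite inord_val; case: b => //=; first by congr Dihedral; rewrite GRing.addr0.
    by congr Dihedral; rewrite GRing.addr0.
  by rewrite groupM // groupX // mem_gen // !(inE, cycle_id) ?orbT.
- by rewrite rhoX modnn; apply/eqP; congr Dihedral; apply: val_inj; rewrite /= inordK.
- by apply/eqP; rewrite expgS expg1; congr Dihedral; apply: GRing.subrr.
- by apply/eqP; congr Dihedral; rewrite GRing.add0r GRing.addr0.
Qed.

End DihedralGroup.

Definition map12 (X : Type) (r : X * X -> X * X) (p : X * X * X) : X * X * X :=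
  let: (x, y, z) := p in (r (x, y), z).
Definition map23 (X : Type) (r : X * X -> X * X) (p : X * X * X) : X * X * X :=
  let: (x, y, z) := p in (x, (r (y, z)).1, (r (y, z)).2).

Definition sigma (X : Type) (r : X * X -> X * X) (x y : X) : X := (r (x, y)).1.
Definition tau (X : Type) (r : X * X -> X * X) (y x : X) : X := (r (x, y)).2.

Record solution := Solution {
  sol_set :> Type;
  sol_map : sol_set * sol_set -> sol_set * sol_set;
  sol_nonempty : inhabited sol_set;
  sol_braid : map12 sol_map \o map23 sol_map \o map12 sol_map =1
              map23 sol_map \o map12 sol_map \o map23 sol_map;
  sol_invol : involutive sol_map;
  sol_sigma_bij : forall x, bijective (sigma sol_map x);
  sol_tau_bij : forall y, bijective (tau sol_map y)
}.

Definition sol_isomorphic (S S' : solution) : Prop :=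
  exists f : S -> S', bijective f /\
    forall p : S * S, sol_map (f p.1, f p.2) =
                      (f (sol_map p).1, f (sol_map p).2).

Definition permutation_group (S : solution) : set (sym S) :=
  generated_subgroup
    [set g : sym S | exists x : S, g =1 sigma (@sol_map S) x]%classic.
Arguments permutation_group : clear implicits.

Definition indecomposable (S : solution) : Prop :=
  acts_transitively (permutation_group S).

Definition uniconnected (S : solution) : Prop :=
  acts_regularly (permutation_group S).

(* Main.v *)
Require Import Defs.
From mathcomp Require Import all_boot.
From mathcomp Require Import boolp ssralg zmodp all_fingroup cyclic pgroup.
From mathcomp Require classical_sets.

(** A solution whose permutation group is a group G acting transitively on X is
    determined by the G-set X and the index map x |-> sigma_x. Choosing a base
    point x0 pulls this back to one map t : G -> G, t g = sigma_(g x0), subject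
    to t g * t (t(g)^-1 h) = t h * t (t(h)^-1 g), the injectivity of
    g |-> t(g)^-1 g and the fact that t(G) generates G. These say that the
    permutations T_h : g |-> g * t (g^-1 h) of the set G commute and generate a
    regular abelian group V, normalised by the left translations L_a because
    L_a T_h L_a^-1 = T_(a h). This V is the additive group of the permutation
    brace, so G and V are two regular groups with a common carrier, and the
    properties of the brace are read off inside Sym(G).

    Let G be dihedral of order 2n with n odd. An involution of V moves every
    point of G, hence is a product of n transpositions and an odd permutation;
    as n is odd there is only one, so it commutes with all L_a and is right
    multiplication by some b of order 2. Sending g to the signature of the
    element of V that maps 1 to g is a homomorphism, nontrivial at b, hence it is
    the character that separates rotations from reflections. All T_h have the
    same signature, being conjugate, so every t h is a reflection.

    Conjugation by L_b acts on the even part V0 of V like c |-> b c b on the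
    rotations, that is without fixed point other than 1, so it inverts V0. It
    also inverts L_a for a rotation a, which forces L_a^2, and therefore L_a, to
    centralise V0. Hence V is the direct product of V0 and the involution, and
    there is a rotation c with t g = c b when g is a rotation and t g = c^-1 b
    otherwise (dihedral_cycle_set).

    A reflection fixing x0 would give c = c^-1, hence c = 1 and a permutation
    group <b> fixing x0, against transitivity; a rotation fixing x0 fixes every
    point, the subgroups of rotations being normal. So the action is regular
    (phi_free), and the solution is the image of the one with b = s and c = rho
    under the automorphism of the dihedral group sending rho to c and s to b
    (model_unique). *)

Set Implicit Arguments.
Unset Strict Implicit.
Unset Printing Implicit Defensive.

(** * Commuting translations of a group attached to an index map *)
Section Cocycle.
Local Open Scope group_scope.
Variables (G : finGroupType) (t : G -> G).
Hypothesis tC : forall g h, t g * t ((t g)^-1 * h) = t h * t ((t h)^-1 * g).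
Hypothesis t_diag : injective (fun g => (t g)^-1 * g).
Hypothesis t_gen : <<[set t h | h : G]>> = [set: G].

Definition lmul (a : G) : {perm G} := perm (@mulgI G a).

(** With u = g^-1 h, the value of the map is h u^-1 t(u), that is h times the
    inverse of t(u)^-1 u: this is where injectivity on the diagonal enters. *)
Fact transl_inj h : injective (fun g => g * t (g^-1 * h)).
Proof.
move=> g k egk; have e : g^-1 * h = k^-1 * h.
  by apply: t_diag; rewrite /= !mulgA -!invMg egk.
by apply: invg_inj; apply: mulIg e.
Qed.

Definition transl (h : G) : {perm G} := perm (@transl_inj h).

Definition transl_group : {group {perm G}} := <<[set transl h | h : G]>>%G.
Local Notation V := transl_group.

Lemma translE h g : transl h g = g * t (g^-1 * h).
Proof. by rewrite permE. Qed.

Lemma lmulE a g : lmul a g = a * g. Proof. by rewrite permE. Qed.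

Lemma lmulM a b : lmul (a * b) = lmul b * lmul a.
Proof. by apply/permP=> g; rewrite permM !lmulE mulgA. Qed.

Lemma lmul1 : lmul 1 = 1.
Proof. by apply/permP=> g; rewrite lmulE perm1 mul1g. Qed.

Lemma lmulV a : lmul a^-1 = (lmul a)^-1.
Proof. by apply: (mulgI (lmul a)); rewrite -lmulM mulVg mulgV lmul1. Qed.

(** The value at g of the product of the two translations is
    g t(u) t(t(u)^-1 w) with u = g^-1 h and w = g^-1 k. *)
Lemma transl_commute h k : commute (transl h) (transl k).
Proof.
apply/permP=> g; rewrite !permM !translE !invMg -!mulgA; congr (_ * _).
by rewrite tC.
Qed.

Lemma translJ h a : transl h ^ lmul a = transl (a * h).
Proof.
apply/permP=> g; rewrite conjgE -lmulV !permM !lmulE !translE.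
by rewrite !mulgA mulgV mul1g invMg invgK.
Qed.

Lemma mem_transl h : transl h \in V.
Proof. by apply: mem_gen; apply: imset_f. Qed.

Lemma transl_group_abelian : abelian V.
Proof.
rewrite /= abelian_gen; apply/centsP => _ /imsetP[h _ ->] _ /imsetP[k _ ->].
exact: transl_commute.
Qed.

Lemma transl_groupC v w : v \in V -> w \in V -> v * w = w * v.
Proof. by move=> vV wV; apply: (centsP transl_group_abelian). Qed.

Lemma transl_groupJ a v : v \in V -> v ^ lmul a \in V.
Proof.
move=> vV; have <- : V :^ lmul a = V; last by rewrite memJ_conjg.
rewrite /= -genJ; congr <<_>>; apply/setP=> s; apply/imsetP/imsetP.
  by move=> [_ /imsetP[h _ ->] ->]; exists (a * h); rewrite ?translJ.
move=> [h _ ->]; exists (transl (a^-1 * h)); first exact: imset_f.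
by rewrite translJ mulKVg.
Qed.

(** From g the translation by g k leads to g * t k, so the orbit of 1 contains
    all products of values of t; in a finite group these exhaust the subgroup
    that the values generate. *)
Lemma transl_group_trans g : exists2 v, v \in V & v 1 = g.
Proof.
have : g \in <<[set t h | h : G]>> by rewrite t_gen inE.
case/gen_prodgP=> m [c ct ->].
elim: m c ct => [|m IHm] c ct; first exists 1.
- exact: group1.
- by rewrite perm1 big_ord0.
rewrite big_ord_recr /=.
have [|v vV <-] := IHm (fun i => c (widen_ord (leqnSn m) i)).
  by move=> i; apply: ct.
have /imsetP[k _ ->] := ct ord_max.
exists (v * transl (v 1 * k)); first by rewrite groupM ?mem_transl.
by rewrite permM translE mulKg.
Qed.

Lemma transl_group_free v w : v \in V -> w \in V -> v 1 = w 1 -> v = w.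
Proof.
move=> vV wV e; apply/permP=> g; have [u uV <-] := transl_group_trans g.
by rewrite -!permM !(transl_groupC uV) // !permM e.
Qed.

Lemma card_transl_group : #|V| = #|G|.
Proof.
rewrite -cardsT -(card_in_imset (f := fun v : {perm G} => v 1) (D := V)).
  congr #|pred_of_set _|; apply/setP=> g; rewrite inE.
  by have [v vV <-] := transl_group_trans g; rewrite imset_f.
by move=> v w; apply: transl_group_free.
Qed.

Fact transl_to_subproof g : exists v, (v \in V) && (v 1 == g).
Proof. by have [v vV <-] := transl_group_trans g; exists v; rewrite vV /=. Qed.

(** The identification of G with V given by regularity. *)
Definition transl_to (g : G) : {perm G} := xchoose (transl_to_subproof g).

Lemma transl_to_in g : transl_to g \in V.
Proof. by case/andP: (xchooseP (transl_to_subproof g)). Qed.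

Lemma transl_to1 g : transl_to g 1 = g.
Proof. by case/andP: (xchooseP (transl_to_subproof g)) => _ /eqP. Qed.

Lemma transl_toE v : v \in V -> transl_to (v 1) = v.
Proof.
by move=> vV; apply: transl_group_free; rewrite ?transl_to_in ?transl_to1.
Qed.

Lemma lmulJ1 a (v : {perm G}) : (v ^ lmul a) a = a * v 1.
Proof. by rewrite conjgE -lmulV !permM !lmulE mulVg. Qed.

(** The bijection G -> V is a 1-cocycle for the conjugation action of G. *)
Lemma transl_toM g h : transl_to (g * h) = transl_to g * transl_to h ^ lmul g.
Proof.
rewrite -[RHS]transl_toE; last first.
  by rewrite groupM ?transl_to_in ?transl_groupJ ?transl_to_in.
by rewrite permM transl_to1 lmulJ1 transl_to1.
Qed.

Lemma transl_to_index h : transl_to (t h) = transl h.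
Proof. by rewrite -(transl_toE (mem_transl h)) translE invg1 !mul1g. Qed.

Definition parity (g : G) : bool := odd_perm (transl_to g).

(** Conjugation does not change the signature, so the cocycle becomes a
    homomorphism once it is composed with the signature. *)
Lemma parityM g h : parity (g * h) = parity g (+) parity h.
Proof. by rewrite /parity transl_toM odd_permM odd_permJ. Qed.

Lemma parity_index_const h : parity (t h) = parity (t 1).
Proof.
by rewrite /parity !transl_to_index -[h in LHS]mulg1 -translJ odd_permJ.
Qed.

(** * The involution of the translation group in order twice an odd number *)
Section TwiceOdd.
Variable n : nat.
Hypothesis n_odd : odd n.
Hypothesis cardG : #|G| = n.*2.

(** The orbits have two points each, so there are n of them, and the parity of a
    permutation is that of #|T| minus its number of orbits. *)
Lemma odd_fpfree_involution (T : finType) (s : {perm T}) :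
  #|T| = n.*2 -> s * s = 1 -> (forall x, s x != x) -> odd_perm s.
Proof.
move=> cT ss1 sx; rewrite /odd_perm cT odd_double /=.
suff /eqP : (#|porbits s| * 2)%N = n.*2.
  by rewrite muln2 (inj_eq double_inj) => /eqP ->.
rewrite -cT -cardsT.
have PT : partition (porbits s) [set: T].
  apply/and3P; split.
  - rewrite eqEsubset subsetT /=; apply/subsetP=> x _.
    by apply/bigcupP; exists (porbit s x); rewrite ?porbit_id ?imset_f.
  - apply/trivIsetP=> _ _ /imsetP[x _ ->] /imsetP[y _ ->].
    apply: contraR => /pred0Pn[z /= /andP[zx zy]].
    by rewrite -!eq_porbit_mem in zx zy; rewrite -(eqP zx) -(eqP zy).
  - apply/imsetP=> [[x _ e]]; have := porbit_id s x; by rewrite -e inE.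
rewrite (card_uniform_partition (n := 2) _ PT) // => _ /imsetP[x _ ->].
have -> : porbit s x = [set x; s x].
  apply/setP=> y; rewrite !inE; apply/porbitP/orP.
    move=> [i ->]; rewrite -(odd_double_half i) expgD -muln2 mulnC expgM expgS.
    rewrite expg1 ss1 expg1n mulg1; case: (odd i); rewrite ?expg1 ?eqxx; auto.
    by rewrite perm1 eqxx; left.
  by case=> /eqP ->; [exists 0%N; rewrite perm1 | exists 1%N; rewrite expg1].
by rewrite cards2 eq_sym sx.
Qed.

Lemma transl_involution_odd s : s \in V -> s * s = 1 -> s != 1 -> odd_perm s.
Proof.
move=> sV ss1 s1; apply: odd_fpfree_involution => // g.
apply: contra s1 => /eqP sg; apply/eqP/transl_group_free => //.
have [u uV ug] := transl_group_trans g; apply: (@perm_inj _ u).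
by rewrite perm1 -permM (transl_groupC sV uV) permM ug.
Qed.

(** Two involutions of V are both odd, so their product is even and cannot be an
    involution: it is 1. The involution s is thus invariant under conjugation by
    left multiplications, and s g = s (L_g 1) = g * s 1. *)
Lemma transl_involution :
  exists b, [/\ b * b = 1, forall g, transl_to b g = g * b & parity b].
Proof.
have [|s sV s2] := @Cauchy _ 2 V isT.
  by rewrite card_transl_group cardG -muln2 dvdn_mull.
have s1 : s != 1 by rewrite -order_gt1 s2.
have ss1 : s * s = 1 by have := expg_order s; rewrite s2.
have sJ a : s ^ lmul a = s.
  apply/eqP; rewrite eq_mulVg1; apply/negPn/negP=> d1.
  have saV := transl_groupJ a sV.
  suff : odd_perm ((s ^ lmul a)^-1 * s).
    by rewrite odd_permM odd_permV odd_permJ addbb.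
  apply: transl_involution_odd => //; first by rewrite groupM ?groupV.
  rewrite -[LHS]/((_ * _) ^+ 2) expgMn; last first.
    by apply: transl_groupC; rewrite ?groupV.
  by rewrite expgVn !expgS !expg0 !mulg1 ss1 -conjMg ss1 conj1g invg1 mulg1.
have sE g : s g = g * s 1.
  have := lmulJ1 g s; by rewrite sJ.
exists (s 1); rewrite /parity transl_toE //; split=> //.
  by rewrite -sE -permM ss1 perm1.
exact: transl_involution_odd.
Qed.

(** The common parity of the generators cannot be even, as b is odd. *)
Lemma parity_index h : parity (t h).
Proof.
have [b [_ _ pb]] := transl_involution.
rewrite parity_index_const; apply: contraLR pb => p1.
have : b \in <<[set t h | h : G]>> by rewrite t_gen inE.
have p0 : parity 1 = false by have := parityM 1 1; rewrite mulg1; case: parity.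
case/gen_prodgP=> m [c ct ->]; elim/big_ind: _ => [|x y|i _].
- by rewrite p0.
- by rewrite parityM; do 2!case: parity.
- by have /imsetP[k _ ->] := ct i; rewrite parity_index_const.
Qed.

End TwiceOdd.
End Cocycle.

(** * Index maps on dihedral groups of order twice an odd number *)
Section DihedralElements.
Local Open Scope group_scope.
Variable n : nat.
Implicit Types a b c u : dihedral n.

Lemma dihedral_mulE i d j e :
  Dihedral i d * Dihedral j e
    = Dihedral (i + (if d then - j else j))%R (d (+) e) :> dihedral n.
Proof. by []. Qed.

Lemma dihedral_invE i d :
  (Dihedral i d)^-1 = Dihedral (if d then i else (- i)%R) d :> dihedral n.
Proof. by []. Qed.

Lemma dihedral1E : 1 = Dihedral 0%R false :> dihedral n.
Proof. by []. Qed.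

Lemma dihedral_refM u (v : dihedral n) :
  dihedral_ref (u * v) = dihedral_ref u (+) dihedral_ref v.
Proof. by case: u v => [i b] [j c]. Qed.

Lemma reflection_involutive b : dihedral_ref b -> b * b = 1.
Proof. by case: b => i [] // _; rewrite dihedral_mulE GRing.subrr. Qed.

Lemma reflection_conj b c :
  dihedral_ref b -> ~~ dihedral_ref c -> b * c * b = c^-1.
Proof.
case: b c => [i []] // [j []] // _ _; rewrite !dihedral_mulE dihedral_invE /=.
by rewrite GRing.addrAC GRing.subrr GRing.add0r.
Qed.

Lemma rotation_commute a c :
  ~~ dihedral_ref a -> ~~ dihedral_ref c -> a * c = c * a.
Proof.
by case: a c => [i []] // [j []] // _ _; rewrite !dihedral_mulE GRing.addrC.
Qed.

Lemma rotationX (i : 'I_n.-1.+1) k :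
  Dihedral i false ^+ k = Dihedral (i *+ k)%R false :> dihedral n.
Proof. by elim: k => [|k IHk] //; rewrite expgS IHk GRing.mulrS. Qed.

Lemma rotation_expn (n0 : 0 < n) c : ~~ dihedral_ref c -> c ^+ n = 1.
Proof.
case: c => i [] // _.
rewrite rotationX dihedral1E; congr Dihedral.
rewrite -[X in (_ *+ X)%R](prednK n0).
by rewrite Zp_mulrn; apply: val_inj; rewrite /= modnMl.
Qed.

Hypothesis n_odd : odd n.

Lemma rotation_sqrt c :
  ~~ dihedral_ref c -> exists2 a, ~~ dihedral_ref a & c = a * a.
Proof.
move=> cR; exists (c ^+ n.+1./2).
  by elim: (n.+1./2) => // k; rewrite expgS dihedral_refM (negPf cR).
have e : (n.+1./2 + n.+1./2)%N = n.+1.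
  by rewrite addnn -[RHS]odd_double_half /= n_odd.
by rewrite -expgD e expgS rotation_expn ?odd_gt0 // mulg1.
Qed.

Lemma rotation_invol c : ~~ dihedral_ref c -> c * c = 1 -> c = 1.
Proof.
move=> cR cc; apply/eqP; rewrite -order_eq1 -dvdn1.
rewrite -(eqP (_ : coprime 2 n)) ?coprime2n // dvdn_gcd !order_dvdn.
by rewrite [c ^+ 2]cc rotation_expn ?odd_gt0 // eqxx.
Qed.

Section CycleSet.
Variable t : dihedral n -> dihedral n.
Hypothesis tC : forall g h, t g * t ((t g)^-1 * h) = t h * t ((t h)^-1 * g).
Hypothesis t_diag : injective (fun g => (t g)^-1 * g).
Hypothesis t_gen : <<[set t h | h : dihedral n]>> = [set: dihedral n].
Local Notation V := (transl_group t_diag).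
Local Notation transl_to := (transl_to t_diag t_gen).
Local Notation parity := (parity t_diag t_gen).
Local Notation lmul := (@lmul (dihedral n)).

Let cardD : #|{: dihedral n}| = n.*2.
Proof. exact: card_dihedral_group (odd_gt0 n_odd). Qed.

(** A rotation is a square, hence even; so b is a reflection, and any reflection
    is the product of a rotation and b. *)
Lemma parity_ref g : parity g = dihedral_ref g.
Proof.
have rot c : ~~ dihedral_ref c -> parity c = false.
  by case/rotation_sqrt=> a _ ->; rewrite (parityM tC) addbb.
have [b [bb _ pb]] := transl_involution tC t_diag t_gen n_odd cardD.
have rb : dihedral_ref b by apply: contraTT pb => /rot ->.
case: (boolP (dihedral_ref g)) => [rg|/rot //].
by rewrite -[g]mulg1 -bb mulgA (parityM tC) pb rot // dihedral_refM rg rb.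
Qed.

(** The even part of V is centralised by the rotations and inverted by the
    reflections, so the conjugates of the generator v * transl_to b of V are
    itself and v^-1 * transl_to b. *)
Lemma dihedral_cycle_set : exists b c,
  [/\ dihedral_ref b, ~~ dihedral_ref c &
      forall g, t g = (if dihedral_ref g then c^-1 else c) * b].
Proof.
have [b [bb trb pb]] := transl_involution tC t_diag t_gen n_odd cardD.
have rb : dihedral_ref b by rewrite -parity_ref.
have bV1 : b^-1 = b by apply: (mulgI b); rewrite mulgV bb.
have lbb : lmul b * lmul b = 1 by rewrite -lmulM bb lmul1.
have trbV := transl_to_in t_diag t_gen b.
have trbb : transl_to b * transl_to b = 1.
  by apply/permP=> g; rewrite permM !trb -mulgA bb mulg1 perm1.
have trbJ a : transl_to b ^ lmul a = transl_to b.
  apply/permP=> g; rewrite conjgE -lmulV !permM !lmulE !trb.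
  by rewrite !mulgA mulgV mul1g.
have lmulJ_at1 v a : v \in V -> (v ^ lmul a) 1 = a * v a^-1.
  by move=> vV; rewrite conjgE -lmulV !permM !lmulE mulg1.
have Jb1 v : v \in V -> (v ^ lmul b) 1 = b * v 1 * b.
  move=> vV; rewrite lmulJ_at1 // bV1.
  have -> : b = transl_to b 1 by rewrite trb mul1g.
  by rewrite -permM (transl_groupC tC trbV vV) permM !trb mul1g mulgA.
(* w = v * v ^ lmul b is even and fixed by lmul b, hence w 1 is a rotation equal
   to its own inverse. *)
have invJ v : v \in V -> ~~ odd_perm v -> v ^ lmul b = v^-1.
  move=> vV v0; have vJ := transl_groupJ b vV.
  have wV : v * v ^ lmul b \in V by rewrite groupM.
  suff w1 : v * v ^ lmul b = 1 by apply: (mulgI v); rewrite w1 mulgV.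
  have wJ : (v * v ^ lmul b) ^ lmul b = v * v ^ lmul b.
    by rewrite conjMg -conjgM lbb conjg1 (transl_groupC tC).
  move: (v * _) wV wJ (odd_permM v (v ^ lmul b)) => w wV wJ.
  rewrite odd_permJ addbb => w0.
  apply: (transl_group_free tC t_gen) => //; rewrite perm1.
  have rw : ~~ dihedral_ref (w 1).
    by rewrite -parity_ref /parity (transl_toE tC) // w0.
  have := Jb1 _ wV; rewrite wJ reflection_conj // => e.
  by apply: rotation_invol => //; rewrite {1}e mulVg.
(* With a = d * d, conjugation by lmul b inverts both the even part of V and
   lmul d; applied to v ^ lmul d it shows that lmul d and its inverse act in the
   same way on v. *)
have centJ v a :
    v \in V -> ~~ odd_perm v -> ~~ dihedral_ref a -> v ^ lmul a = v.
  move=> vV v0 /rotation_sqrt[d rd ->].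
  have := invJ (v ^ lmul d); rewrite transl_groupJ // odd_permJ => /(_ isT v0).
  have -> : (v ^ lmul d) ^ lmul b = (v ^ lmul b) ^ (lmul d^-1).
    rewrite -!conjgM -!lmulM; congr (_ ^ lmul _).
    by rewrite -(reflection_conj rb rd) -mulgA bb mulg1.
  rewrite invJ // conjVg => /invg_inj e.
  by rewrite lmulM conjgM -e -conjgM -lmulM mulgV lmul1 conjg1.
(* The even component of the first generator; its value at 1 is c. *)
have [v [vV v0 tE]] : exists v : {perm dihedral n},
    [/\ v \in V, ~~ odd_perm v & transl t_diag 1 = v * transl_to b].
  exists (transl t_diag 1 * transl_to b).
  split; [by rewrite groupM ?mem_transl | | by rewrite -mulgA trbb mulg1].
  have pt1 := parity_index tC t_diag t_gen n_odd cardD 1.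
  rewrite /parity (transl_to_index tC t_diag t_gen) in pt1.
  by rewrite odd_permM pt1; move: pb; rewrite /parity => ->.
have vbJ (w : {perm dihedral n}) a :
    (w * transl_to b) ^ lmul a = w ^ lmul a * transl_to b.
  by rewrite conjMg trbJ.
have t1 g : t g = transl t_diag g 1 by rewrite translE invg1 !mul1g.
have trot a : ~~ dihedral_ref a -> transl t_diag a = v * transl_to b.
  by move=> ra; rewrite -[a]mulg1 -translJ tE vbJ centJ.
have tref a : ~~ dihedral_ref a -> transl t_diag (a * b) = v^-1 * transl_to b.
  move=> ra; rewrite -translJ -[b in transl _ b]mulg1 -translJ tE !vbJ.
  by rewrite invJ // centJ ?groupV ?odd_permV.
exists b, (v 1); split=> //.
  by rewrite -parity_ref /parity (transl_toE tC).
move=> g; case: (boolP (dihedral_ref g)) => rg.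
  have -> : g = g * b * b by rewrite -mulgA bb mulg1.
  rewrite t1 tref ?dihedral_refM ?rg ?rb // permM trb -invJ // Jb1 //.
  by rewrite reflection_conj // -parity_ref /parity (transl_toE tC).
by rewrite t1 trot // permM trb.
Qed.

End CycleSet.
End DihedralElements.

(** * The maps of a solution *)
Section SolutionFacts.
Variable S : solution.
Local Notation r := (@sol_map S).
Local Notation sg := (sigma r).
Local Notation ta := (tau r).

Lemma sol_mapE x y : r (x, y) = (sg x y, ta y x).
Proof. by rewrite /sigma /tau; case: (r _). Qed.

Lemma sigma_sigma_tau x y : sg (sg x y) (ta y x) = x.
Proof.
have e : r (sg x y, ta y x) = (x, y) by rewrite -sol_mapE sol_invol.
by rewrite {1}/sigma e.
Qed.

Lemma sigma_braid x y z : sg x (sg y z) = sg (sg x y) (sg (ta y x) z).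
Proof.
have := congr1 (fun p => p.1.1) (sol_braid (x, y, z)).
by rewrite /=; do !rewrite sol_mapE /=.
Qed.

(** If sigma_x w = x then (x, w) is fixed by r, so tau_w x = w; tau_w being
    injective, w determines x. *)
Lemma sigma_fixed_diag x y w : sg x w = x -> sg y w = y -> x = y.
Proof.
have tw u : sg u w = u -> ta w u = w.
  move=> uw; have := sigma_sigma_tau u w; rewrite uw.
  by move=> e; apply: (bij_inj (sol_sigma_bij u)); rewrite e uw.
move=> xw yw; apply: (bij_inj (sol_tau_bij w)); rewrite !tw //.
Qed.

End SolutionFacts.

(** By involutivity tau_y x is the preimage of x under sigma_(sigma_x y), so the
    sigma maps determine r. *)
Lemma sigma_sol_isomorphic (S S' : solution) (f : S -> S') :
  bijective f ->
  (forall x y, f (sigma (@sol_map S) x y) = sigma (@sol_map S') (f x) (f y)) ->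
  sol_isomorphic S S'.
Proof.
move=> f_bij fs; exists f; split=> // -[x y] /=.
rewrite !sol_mapE /= fs; congr pair.
apply: (bij_inj (sol_sigma_bij (sigma (@sol_map S') (f x) (f y)))).
by rewrite sigma_sigma_tau -!fs sigma_sigma_tau.
Qed.

(** * Indecomposable solutions with dihedral permutation group *)
Section DihedralSolution.
Local Open Scope group_scope.
Variables (n : nat) (S : solution).
Hypothesis n_odd : odd n.
Variable phi : dihedral n -> sym S.
Hypothesis phiM : {morph phi : u v / u * v}.
Hypothesis phi_inj : injective phi.
Hypothesis phi_range : classical_sets.range phi = permutation_group S.
Hypothesis S_indec : indecomposable S.
Local Notation sg := (sigma (@sol_map S)).

Lemma phi_in g : permutation_group S (phi g).
Proof. by rewrite -phi_range; exists g. Qed.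

Lemma phi1 : phi 1 = 1.
Proof. by apply: (@mulgI _ (phi 1)); rewrite -phiM !mulg1. Qed.

Lemma phi1E x : phi 1 x = x. Proof. by rewrite phi1. Qed.

Lemma phiME u v x : phi (u * v) x = phi u (phi v x).
Proof. by rewrite phiM. Qed.

Lemma phiVK u : cancel (phi u) (phi u^-1).
Proof. by move=> x; rewrite -phiME mulVg phi1E. Qed.

Lemma phiKV u : cancel (phi u^-1) (phi u).
Proof. by move=> x; rewrite -phiME mulgV phi1E. Qed.

Lemma phi_trans x y : exists g, phi g x = y.
Proof.
by have [s [+ <-]] := S_indec x y; rewrite -phi_range => -[g _ <-]; exists g.
Qed.

Lemma sigma_index_ex x : exists g, phi g =1 sg x.
Proof.
have [f' fK f'K] := sol_sigma_bij x.
have : permutation_group S (Defs.Sym fK f'K).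
  by move=> H [_ HS]; apply: HS; exists x.
by rewrite -phi_range => -[g _ e]; exists g => y; rewrite e.
Qed.

Definition sigma_index x : dihedral n := projT1 (cid (sigma_index_ex x)).
Local Notation s := sigma_index.

Lemma sigma_indexE x y : phi (s x) y = sg x y.
Proof. by rewrite /sigma_index; case: cid. Qed.

(** The braid equation on the first coordinate, with sigma_x^-1 y in place of
    y. *)
Lemma sigma_index_cycle x y :
  s x * s (phi (s x)^-1 y) = s y * s (phi (s y)^-1 x).
Proof.
apply: phi_inj; apply: symP => z; rewrite !phiME !sigma_indexE sigma_braid.
have e : sg x (phi (s x)^-1 y) = y by rewrite -sigma_indexE phiKV.
rewrite e; congr (sg y (sg _ z)).
rewrite -[LHS](phiVK (s y)); congr (phi _ _).
by rewrite sigma_indexE -[X in sg X _]e sigma_sigma_tau.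
Qed.

Lemma sigma_index_diag x y : phi (s x)^-1 x = phi (s y)^-1 y -> x = y.
Proof.
move=> e; apply: (@sigma_fixed_diag _ _ _ (phi (s x)^-1 x)).
  by rewrite -sigma_indexE phiKV.
by rewrite e -sigma_indexE phiKV.
Qed.

Section Orbit.
Variable x0 : S.
Let t g := s (phi g x0).

Fact orbit_index_cycle g h : t g * t ((t g)^-1 * h) = t h * t ((t h)^-1 * g).
Proof. by rewrite /t !phiME sigma_index_cycle. Qed.

Fact orbit_index_diag : injective (fun g => (t g)^-1 * g).
Proof.
move=> g h e; have xy : phi g x0 = phi h x0.
  apply: sigma_index_diag; rewrite -!phiME.
  exact: (congr1 (fun u => phi u x0) e).
by move: e; rewrite /t xy => /mulgI.
Qed.

(** The image under phi of the subgroup generated by the values of t is a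
    subgroup of Sym X containing every sigma_x, since the orbit of x0 is X. *)
Fact orbit_index_gen : <<[set t h | h : dihedral n]>> = [set: dihedral n].
Proof.
apply/setP=> g; rewrite inE; set K := <<_>>.
suff [k kK /phi_inj <-] : exists2 k, k \in K & phi k = phi g by [].
apply: (@phi_in g (fun f => exists2 k, k \in K & phi k = f)); split.
  split.
  - by exists 1; [exact: group1 | exact: phi1].
  - move=> _ _ [k kK <-] [l lK <-]; exists (k * l); first exact: groupM.
    exact: phiM.
  - move=> _ [k kK <-]; exists k^-1; first by rewrite groupV.
    by apply: (@mulgI _ (phi k)); rewrite -phiM !mulgV phi1.
move=> f [x fx]; have [h hx] := phi_trans x0 x.
exists (t h); first by apply: mem_gen; apply: imset_f.
by apply: symP => y; rewrite fx sigma_indexE hx.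
Qed.

Lemma orbit_index_form : exists b c : dihedral n,
  [/\ dihedral_ref b, ~~ dihedral_ref c &
      forall g, s (phi g x0) = (if dihedral_ref g then c^-1 else c) * b].
Proof.
exact: (dihedral_cycle_set n_odd orbit_index_cycle orbit_index_diag
  orbit_index_gen).
Qed.

(** For a reflection g fixing x0, the equality t g = t 1 forces c = 1; the group
    is then {1, b} with b = g, which fixes the single orbit pointwise. For a
    rotation g, the group generated by g is normal, so g fixes every point. *)
Lemma phi_free g : phi g x0 = x0 -> g = 1.
Proof.
have fixall k : (forall x, phi k x = x) -> k = 1.
  by move=> kx; apply: phi_inj; apply: symP => x; rewrite kx phi1E.
have [b [c [rb rc tE]]] := orbit_index_form.
have bb := reflection_involutive rb.
move=> gx; case: (boolP (dihedral_ref g)) => rg.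
  have c1 : c = 1.
    apply: (rotation_invol n_odd rc).
    have := tE 1; rewrite -[in LHS]gx -phiME mul1g tE rg /=.
    by move=> /mulIg e; rewrite -{1}e mulVg.
  have tb k : t k = b by rewrite /t tE c1 invg1 if_same mul1g.
  have D1b k : k = 1 \/ k = b.
    have : k \in <<[set t h | h : dihedral n]>> by rewrite orbit_index_gen inE.
    rewrite (_ : [set t h | h : dihedral n] = [set b]); last first.
      apply/setP=> u; rewrite inE; apply/imsetP/eqP; first by case=> h _ ->.
      by move=> ->; exists 1; rewrite ?tb.
    rewrite -/(cycle b) => /cycleP[i ->]; rewrite -(odd_double_half i) expgD.
    by rewrite -muln2 mulnC expgM [b ^+ 2]bb expg1n mulg1; case: (odd i); auto.
  have gb : g = b by have [g1|//] := D1b g; rewrite g1 in rg.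
  suff b1 : b = 1 by rewrite b1 in rb.
  apply: fixall => x; have [k <-] := phi_trans x0 x.
  by have [->|->] := D1b k; rewrite ?phi1E -gb !gx.
apply: fixall => x; have [h <-] := phi_trans x0 x; rewrite -phiME.
case: (boolP (dihedral_ref h)) => rh; last first.
  rewrite (_ : g * h = h * g) ?phiME ?gx //.
  exact: rotation_commute.
have hh := reflection_involutive rh.
have -> : g * h = h * g^-1.
  by rewrite -(reflection_conj rh rg) -!mulgA [RHS]mulgA hh mul1g.
by rewrite phiME -{1}gx phiVK.
Qed.

End Orbit.

Lemma dihedral_uniconnected : uniconnected S.
Proof.
move=> x y; have [g gx] := phi_trans x y; exists (phi g).
split; first by split; [exact: phi_in|].
move=> f [+ fx]; rewrite -phi_range => -[h _ eh]; rewrite -eh in fx *.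
suff -> : g = h by [].
apply/eqP; rewrite eq_mulVg1; apply/eqP/(@phi_free x).
by rewrite phiME fx -gx phiVK.
Qed.

End DihedralSolution.

(** * The solution on the dihedral group itself *)
Section Model.
Local Open Scope group_scope.
Variable n : nat.
Notation one := (inZp 1 : 'I_n.-1.+1).

(** The two reflections rho s and rho^-1 s, which are the values of sigma at
    rotations and at reflections respectively. *)
Definition model_index (d : bool) : dihedral n :=
  Dihedral (if d then (- one)%R else one) true.
Local Notation s := model_index.

Definition model_map (p : dihedral n * dihedral n) :=
  (s (dihedral_ref p.1) * p.2, s (~~ dihedral_ref p.2) * p.1).

Lemma model_index_involutive d : s d * s d = 1.
Proof. exact: reflection_involutive. Qed.

Lemma model_indexK d u : s d * (s d * u) = u.
Proof. by rewrite mulgA model_index_involutive mul1g. Qed.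

Lemma model_ref d u : dihedral_ref (s d * u) = ~~ dihedral_ref u.
Proof. by rewrite dihedral_refM. Qed.

(** The braid equation amounts to this exchange rule: for d = e both sides are
    the identity, and for d <> e they coincide. *)
Lemma model_index_swap d e u : s d * (s e * u) = s (~~ e) * (s (~~ d) * u).
Proof. by case: d e => [] [] //; rewrite !model_indexK. Qed.

Fact model_braid : map12 model_map \o map23 model_map \o map12 model_map =1
                   map23 model_map \o map12 model_map \o map23 model_map.
Proof.
move=> [[u v] w]; rewrite /= /model_map /= !model_ref !negbK.
by congr (_, _, _); rewrite model_index_swap ?negbK.
Qed.

Fact model_invol : involutive model_map.
Proof.
by move=> [u v]; rewrite /model_map /= !model_ref !negbK !model_indexK.
Qed.

Fact model_sigma_bij u : bijective (sigma model_map u).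
Proof.
by exists (sigma model_map u) => v; rewrite /sigma /= model_indexK.
Qed.

Fact model_tau_bij u : bijective (tau model_map u).
Proof.
by exists (tau model_map u) => v; rewrite /tau /= model_indexK.
Qed.

Definition model : solution :=
  Solution (inhabits 1) model_braid model_invol model_sigma_bij model_tau_bij.

Definition model_act (g : dihedral n) : sym model :=
  Defs.Sym (mulKg g) (mulKVg g).

Lemma model_actM : {morph model_act : u v / u * v}.
Proof. by move=> u v; apply: symP => x /=; rewrite mulgA. Qed.

Lemma model_act_inj : injective model_act.
Proof.
by move=> u v /(congr1 (fun f : sym model => f 1)) /=; rewrite !mulg1.
Qed.

Hypothesis n_odd : odd n.

(** The product of the two reflections is rho^2, of which rho is a power as n is
    odd. *)
Lemma model_index_gen : <<[set s d | d : bool]>> = [set: dihedral n].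
Proof.
set K := <<_>>; have sK d : s d \in K by apply: mem_gen; apply: imset_f.
have rhoK : Dihedral one false \in K.
  set rho := Dihedral _ _; have rho_r : ~~ dihedral_ref rho by [].
  rewrite -[rho]mulg1 -(rotation_expn (odd_gt0 n_odd) rho_r) -expgS.
  rewrite -[n.+1]odd_double_half /= n_odd add0n -mul2n expgM.
  suff -> : rho ^+ 2 = s false * s true by rewrite groupX ?groupM.
  by rewrite rotationX dihedral_mulE GRing.opprK.
have rotK i : Dihedral i false \in K.
  have -> : Dihedral i false = Dihedral one false ^+ i :> dihedral n.
    rewrite rotationX; congr Dihedral; rewrite Zp_mulrn; apply: val_inj => /=.
    by rewrite modnMml mul1n modn_small.
  exact: groupX.
apply/setP=> -[i [|]]; rewrite [RHS]inE ?rotK //.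
have -> : Dihedral i true = Dihedral (i - one)%R false * s false :> dihedral n.
  by rewrite dihedral_mulE GRing.subrK.
by rewrite groupM ?rotK ?sK.
Qed.

Lemma model_act_range :
  classical_sets.range model_act = permutation_group model.
Proof.
apply/predeqP=> f; split.
  move=> [g _ <-] H [[H1 HM HV] HS].
  have : g \in <<[set s d | d : bool]>> by rewrite model_index_gen inE.
  case/gen_prodgP=> m [a aS ->]; elim/big_ind: _ => [|u v Hu Hv|i _].
  - by rewrite (_ : model_act 1 = 1) //; apply: symP => x; rewrite /= mul1g.
  - by rewrite model_actM; apply: HM.
  - have /imsetP[d _ ->] := aS i; apply: HS.
    by exists (Dihedral 0%R d) => v.
apply; split.
  split.
  - by exists 1 => //; apply: symP => x; rewrite /= mul1g.
  - by move=> _ _ [g _ <-] [h _ <-]; exists (g * h); rewrite ?model_actM.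
  - by move=> _ [g _ <-]; exists g^-1 => //; apply: symP.
move=> h [u hu]; exists (s (dihedral_ref u)) => //.
by apply: symP => v; rewrite hu.
Qed.

Lemma model_indecomposable : indecomposable model.
Proof.
move=> x y; exists (model_act (y * x^-1)); split; last exact: mulgKV.
by rewrite -model_act_range; exists (y * x^-1).
Qed.

Section Endomorphism.
Variables b c : dihedral n.
Hypotheses (rb : dihedral_ref b) (rc : ~~ dihedral_ref c).

(** The endomorphism sending rho to c and s to b. *)
Definition dihedral_map (u : dihedral n) : dihedral n :=
  c ^+ dihedral_rot u * (if dihedral_ref u then b else 1).

Lemma dihedral_mapM : {morph dihedral_map : u v / u * v}.
Proof.
have n0 := odd_gt0 n_odd; have bb := reflection_involutive rb.
have cn : c ^+ n.-1.+1 = 1 by rewrite prednK // rotation_expn.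
have cD (i j : 'I_n.-1.+1) : c ^+ (i + j)%R = c ^+ i * c ^+ j.
  by rewrite /= (expg_mod _ cn) expgD.
have cN (i : 'I_n.-1.+1) : c ^+ (- i)%R = (c ^+ i)^-1.
  by apply: (mulgI (c ^+ i)); rewrite mulgV -cD GRing.subrr.
have cb i : b * c ^+ i = (c ^+ i)^-1 * b.
  rewrite -(reflection_conj rb) -?mulgA ?bb ?mulg1 //.
  by elim: i => // i IHi; rewrite expgS dihedral_refM (negPf rc).
move=> [i d] [j e]; rewrite /dihedral_map dihedral_mulE [dihedral_rot _]/=.
rewrite !/(dihedral_ref _) cD /=.
rewrite /= in cN; case: d => /=; last by rewrite mulg1 mulgA.
rewrite cN -!mulgA; congr (_ * _); rewrite [RHS]mulgA cb -mulgA.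
by case: e; rewrite ?bb ?mulg1.
Qed.

Lemma dihedral_map_ref u : dihedral_ref (dihedral_map u) = dihedral_ref u.
Proof.
rewrite dihedral_refM; have -> : dihedral_ref (c ^+ dihedral_rot u) = false.
  elim: (nat_of_ord _) => // i IHi; by rewrite expgS dihedral_refM (negPf rc).
by case: (dihedral_ref u).
Qed.

Lemma dihedral_map_index d : dihedral_map (s d) = (if d then c^-1 else c) * b.
Proof.
have cn : c ^+ n.-1.+1 = 1 by rewrite prednK ?rotation_expn ?odd_gt0.
rewrite /dihedral_map /=; congr (_ * _).
have c1 : c ^+ one = c by rewrite /= (expg_mod _ cn) expg1.
case: d => //; rewrite -[in RHS]c1; apply: (mulgI (c ^+ one)).
rewrite mulgV -expgD -(expg_mod _ cn).
by have /(congr1 val) /= -> := GRing.subrr one.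
Qed.

End Endomorphism.

(** The isomorphism is u |-> psi(u) x0, where psi sends rho to c and s to b. It
    carries the generators rho^(+-1) s of the model to the index values
    c^(+-1) b; these generate the dihedral group, so psi is surjective, and the
    action on x0 is free. *)
Lemma model_unique (S : solution) :
  indecomposable S -> subgroup_isom (dihedral n) (permutation_group S) ->
  sol_isomorphic model S.
Proof.
move=> S_indec [phi [phiM phi_inj phi_range]].
have [x0] := sol_nonempty S.
have [b [c [rb rc tE]]] :=
  orbit_index_form n_odd phiM phi_inj phi_range S_indec x0.
have gen := orbit_index_gen phiM phi_inj phi_range S_indec x0.
pose psi := dihedral_map b c.
have psiM : {morph psi : u v / u * v} := dihedral_mapM rb rc.
have psi1 : psi 1 = 1 by rewrite /psi /dihedral_map expg0 mulg1.
have psi_surj g : exists u, psi u = g.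
  have KG : group_set [set psi u | u : dihedral n].
    apply/group_setP; split; first by apply/imsetP; exists 1.
    move=> _ _ /imsetP[u _ ->] /imsetP[v _ ->].
    by apply/imsetP; exists (u * v); rewrite ?psiM.
  suff : g \in <<[set psi u | u : dihedral n]>>.
    by rewrite (gen_set_id KG) => /imsetP[u _ ->]; exists u.
  have : g \in [set: dihedral n] by rewrite inE.
  rewrite -gen; apply/subsetP/genS/subsetP => _ /imsetP[h _ ->].
  by rewrite tE -dihedral_map_index // imset_f.
have psi_inj : injective psi.
  have /image_injP psi_inj : #|image psi predT| == #|{: dihedral n}|.
    apply/eqP/eq_card => g; have [u <-] := psi_surj g; exact: image_f.
  by move=> u v; apply: psi_inj.
pose f (u : model) : S := phi (psi u) x0.
apply: (@sigma_sol_isomorphic _ _ f).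
  have f_inj : injective f.
    move=> u v; rewrite /f => e; apply: psi_inj; apply/eqP; rewrite eq_mulVg1.
    apply/eqP.
    apply: (phi_free n_odd phiM phi_inj phi_range S_indec (x0 := x0)).
    by rewrite (phiME phiM) -e (phiVK phiM).
  have f_surj y : exists u, f u = y.
    have [h <-] := phi_trans phi_range S_indec x0 y.
    by have [u <-] := psi_surj h; exists u.
  have [g gK] := choice f_surj.
  by exists g => // u; apply: f_inj; rewrite gK.
move=> u v; rewrite /f -(sigma_indexE phi_range) tE -(phiME phiM).
by rewrite /psi dihedral_map_ref // -dihedral_map_index // -psiM.
Qed.

End Model.

Theorem theorem3p3 (n : nat) (hn : odd n) :
  (exists S : solution,
     [/\ indecomposable S,
         subgroup_isom (dihedral n) (permutation_group S)
       & forall S' : solution,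
           indecomposable S' ->
           subgroup_isom (dihedral n) (permutation_group S') ->
           sol_isomorphic S S']) /\
  (forall S : solution,
     indecomposable S ->
     subgroup_isom (dihedral n) (permutation_group S) ->
     uniconnected S).
Proof.
split; last first.
  move=> S S_indec [phi [phiM phi_inj phi_range]].
  exact (dihedral_uniconnected hn phiM phi_inj phi_range S_indec).
exists (model n); split; [exact: model_indecomposable | | exact: model_unique].
exists (@model_act n); split; last exact: model_act_range.
- exact: model_actM.
- exact: model_act_inj.
Qed.
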